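(* Let $\mathfrak g$ be the $6$-dimensional real filiform Lie algebra with basis $\{X_1,\dots,X_6\}$ whose only nonzero relations (up to antisymmetry) are $$[X_1,X_i]=X_{i+1}\ \text{ for } i=2,\dots,5,\qquad [X_2,X_3]=-X_6.$$ For no choice of inner product on $\mathfrak g$ does $\mathfrak g$ possess a proper totally geodesic subalgebra of dimension greater than two.
   Context: Given an inner product $\langle\cdot,\cdot\rangle$ on a finite-dimensional real Lie algebra $\mathfrak g$ (arbitrary; no compatibility with the bracket is assumed), the Levi-Civita connection $\nabla$ is given by $2\langle\nabla_XY,Z\rangle=\langle[X,Y],Z\rangle+\langle[Z,X],Y\rangle+\langle[Z,Y],X\rangle$ for all $X,Y,Z\in\mathfrak g$. A subalgebra $\mathfrak h$ of $\mathfrak g$ is totally geodesic (relative to the inner product) if $\nabla_YZ\in\mathfrak h$ for all $Y,Z\in\mathfrak h$. Proper means $\mathfrak h\neq\mathfrak g$. *)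

(* Defs.v *)
From HB Require Import structures.
From mathcomp Require Import all_boot all_order all_algebra.
From mathcomp Require Import ring.
From mathcomp Require Import boolp classical_sets reals.

Set Implicit Arguments.
Unset Strict Implicit.
Unset Printing Implicit Defensive.
Import Order.TTheory GRing.Theory Num.Theory.
Local Open Scope ring_scope.

Section LieAlgebras.
Variables (R : realType) (g : vectType R) (br : {bilinear g -> g -> g}).

Definition is_lie_bracket : Prop :=
  (forall x, br x x = 0) /\
  (forall x y z, br x (br y z) + br y (br z x) + br z (br x y) = 0).

Definition subalgebra (h : {vspace g}) : Prop :=
  forall x y, x \in h -> y \in h -> br x y \in h.

(* [{dot g for idfun}] is the type of positive definite symmetric bilinear
   forms on g with values in R. *)
Variable ip : {dot g for (idfun : R -> R)}.

Definition koszul (x y w : g) : Prop :=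
  forall z, 2 * ip w z = ip (br x y) z + ip (br z x) y + ip (br z y) x.

(* The default value 0 is never used: see [levi_civitaP]. *)
Definition levi_civita (x y : g) : g := xget 0 [set w | koszul x y w].

Definition totally_geodesic (h : {vspace g}) : Prop :=
  forall y z, y \in h -> z \in h -> levi_civita y z \in h.

Lemma dot_nondegenerate u : (forall z, ip u z = 0) -> u = 0.
Proof.
move=> u0; apply/eqP/negPn/negP => /(@neq0_dnorm_gt0 _ _ _ ip).
by rewrite u0 ltxx.
Qed.

Lemma koszul_unique x y w w' : koszul x y w -> koszul x y w' -> w = w'.
Proof.
move=> kw kw'; apply/eqP; rewrite -subr_eq0; apply/eqP.
apply: dot_nondegenerate => z; rewrite linearBl /=; apply/eqP.
rewrite subr_eq0 -(inj_eq (mulfI (_ : (2 : R) != 0))) ?pnatr_eq0 //.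
by rewrite kw kw'.
Qed.

Lemma dot_riesz (phi : g -> R) :
  (forall a u v, phi (a *: u + v) = a * phi u + phi v) ->
  exists w, forall z, ip w z = phi z.
Proof.
move=> phiL; pose e := vbasis {:g}.
pose T (w : g) : 'rV[R]_(\dim {:g}) := \row_i ip w e`_i.
have TL : linear T.
  move=> a u v; apply/rowP => i; rewrite !mxE linearDl /=.
  by rewrite linearZl_LR.
pose TT : {linear g -> 'rV[R]_(\dim {:g})} :=
  HB.pack T (GRing.isLinear.Build _ _ _ _ T TL).
have phi0 : phi 0 = 0.
  by have := phiL (-1) 0 0; rewrite scaler0 addr0 mulN1r addNr.
have ext w : (forall i : 'I_(\dim {:g}), ip w e`_i = phi e`_i) ->
    forall z, ip w z = phi z.
  move=> H z; rewrite (coord_vbasis (memvf z)).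
  elim/big_rec: _ => [|i u _ IH]; first by rewrite linear0r phi0.
  by rewrite phiL linearDr /= linearZr_LR /= H IH.
have ker0 : lker (linfun TT) = 0%VS.
  apply/eqP; rewrite -subv0; apply/subvP => u.
  rewrite memv_ker memv0 lfunE /= => /eqP Tu.
  apply/eqP/dot_nondegenerate => z.
  rewrite (coord_vbasis (memvf z)) linear_sumr big1 // => i _.
  rewrite linearZr_LR /=.
  by move/rowP: Tu => /(_ i); rewrite !mxE => ->; rewrite mulr0.
have img : limg (linfun TT) = fullv.
  apply/eqP; rewrite eqEdim subvf /= limg_dim_eq ?ker0 ?capv0 //.
  by rewrite dimvf /dim /= mul1n.
have /memv_imgP[w _ Tw] : (\row_i phi e`_i : 'rV[R]_(\dim {:g}))
    \in limg (linfun TT) by rewrite img memvf.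
exists w; apply: ext => i.
by move/rowP: Tw => /(_ i); rewrite lfunE /= !mxE => ->.
Qed.

Lemma levi_civitaP x y : koszul x y (levi_civita x y).
Proof.
have [|w Hw] := @dot_riesz
    (fun z => (ip (br x y) z + ip (br z x) y + ip (br z y) x) / 2).
  move=> a u v; rewrite !(linearDl, linearDr) /= !linearZl_LR !linearZr_LR /=.
  by field.
suff kw : [set w | koszul x y w]%classic w by exact: (xgetPex 0 (ex_intro _ w kw)).
by move=> z; rewrite Hw mulrCA mulfV ?mulr1 // pnatr_eq0.
Qed.

End LieAlgebras.

(* Main.v *)
From HB Require Import structures.
Require Import Defs.
From mathcomp Require Import all_boot all_order all_algebra.
From mathcomp Require Import ring zify.
From mathcomp Require Import boolp reals.

Set Implicit Arguments.
Unset Strict Implicit.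
Unset Printing Implicit Defensive.
Import Order.TTheory GRing.Theory Num.Theory.
Local Open Scope ring_scope.

(** For y, y' in a totally geodesic subalgebra h and z orthogonal to h, the
    Koszul formula loses the terms pairing h with z and becomes
    <[z,y],y'> + <[z,y'],y> = 0: the compression to h of ad z is
    skew-symmetric ([totally_geodesic_skew]).  A skew-symmetric operator which
    is nilpotent vanishes ([skew_nilpotent_eq0]).  The theorem follows from
    these two facts and an analysis of the position of h with respect to two
    ideals: the codimension-one ideal V spanned by X_2, ..., X_6, and the span
    C of X_4, X_5, X_6, which is the center of V.

    First, h lies in V ([sub_ideal]).  Take the last X_i outside h; brackets
    with X_i land in the span of the later vectors, so its component z
    orthogonal to h normalizes h, hence ad z is skew and nilpotent on h and z
    centralizes h.  But an element y outside V commutes only with combinations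
    of y and X_6.  As h has dimension at least two, ad y kills some nonzero
    vector of the intersection of h and V, so y in h would force X_6 in h,
    hence z in h and z = 0: a contradiction.

    On V the bracket is [x,y] = - area(x,y) X_6, where area is the determinant
    of the coordinates along X_2 and X_3.  Since h lies in V, some z orthogonal
    to h has X_1-coordinate 1, and ad z shifts X_2 -> X_3 -> X_4 -> X_5 -> X_6
    up to terms in X_6.
    - If X_6 is orthogonal to h, then X_6 is not in h and area vanishes on h,
      so the intersection of h and C is large: it contains x in the span of
      X_4, X_6 and y in the span of X_5, X_6, both nonzero, and skewness of
      ad z on this pair forces y = 0 ([perp_X6_absurd]).
    - Otherwise, skewness of ad w for w in V orthogonal to h shows that
      area(w,h) = 0 ([perp_area]).  If area vanishes on h, then h = C and
      ad z X_5 = X_6, ad z X_6 = 0 contradict skewness ([isotropic_absurd]).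
      If not, every such w lies in C, so the compression of ad z to h still
      shifts X_2 -> X_3 modulo C; but it is nilpotent, hence zero
      ([symplectic_absurd]). *)

(** * Skew-symmetry and orthogonal projection *)

Section InnerProduct.
Variables (R : realType) (g : vectType R) (ip : {dot g for (idfun : R -> R)}).
Implicit Types (h : {vspace g}) (x y z : g).

Lemma dotC x y : ip x y = ip y x.
Proof. by rewrite hermC mul1r. Qed.

Lemma dot_eq0 x : ip x x = 0 -> x = 0.
Proof.
move=> xx; apply/eqP/negPn/negP => /(@neq0_dnorm_gt0 _ _ _ ip).
by rewrite xx ltxx.
Qed.

(** Pairing with a basis of h is injective on h because the form is definite,
    so by equality of dimensions it is onto already from h. *)
Lemma orthogonal_projection h x :
  exists2 y, y \in h & forall v, v \in h -> ip (x - y) v = 0.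
Proof.
pose T z : 'rV[R]_(\dim h) := \row_i ip z (vbasis h)`_i.
have Tlin : linear T.
  by move=> a u v; apply/rowP => i; rewrite !mxE linearDl linearZl_LR.
pose L : {linear g -> 'rV[R]_(\dim h)} :=
  HB.pack T (GRing.isLinear.Build _ _ _ _ T Tlin).
have perp z : L z = 0 -> forall v, v \in h -> ip z v = 0.
  move=> /rowP Lz v /coord_vbasis ->; rewrite linear_sumr big1 // => i _.
  by rewrite linearZr_LR /=; move: (Lz i); rewrite !mxE => ->; rewrite mulr0.
have inj : (h :&: lker (linfun L) = 0)%VS.
  apply/eqP; rewrite -subv0; apply/subvP => z.
  rewrite memv_cap memv_ker memv0 lfunE => /andP[zh /eqP Lz].
  by apply/eqP/dot_eq0/perp.
have onto : (linfun L @: h = fullv)%VS.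
  by apply/eqP; rewrite eqEdim subvf /= limg_dim_eq ?inj // dimvf /dim /= mul1n.
have /memv_imgP[y yh Lxy] : L x \in (linfun L @: h)%VS by rewrite onto memvf.
exists y => // v; apply: perp.
by rewrite linearB Lxy lfunE subrr.
Qed.

(** If f (f v) = 0 then <f v, f v> = - <f (f v), v> = 0, so the exponent of
    nilpotency can be lowered down to one.  The map f need not be linear,
    which allows compressions given by an arbitrary choice of projections. *)
Lemma skew_nilpotent_eq0 h (f : g -> g) n y :
  (forall v, v \in h -> f v \in h) ->
  (forall u v, u \in h -> v \in h -> ip (f u) v + ip (f v) u = 0) ->
  y \in h -> iter n.+1 f y = 0 -> f y = 0.
Proof.
move=> fh skew yh; elim: n => [//|n IHn] fny0.
have iterh m : iter m f y \in h by elim: m => //= m; apply: fh.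
apply/IHn/dot_eq0 => /=.
have := skew _ _ (iterh n.+1) (iterh n).
by rewrite /= in fny0 *; rewrite fny0 linear0l add0r.
Qed.

(** The Koszul formula for u, v in h tested against z: both the connection
    term and [u,v] lie in h, hence are orthogonal to z. *)
Lemma totally_geodesic_skew (br : {bilinear g -> g -> g}) h :
    subalgebra br h -> totally_geodesic br ip h ->
  forall z, (forall v, v \in h -> ip z v = 0) ->
  forall u v, u \in h -> v \in h -> ip (br z u) v + ip (br z v) u = 0.
Proof.
move=> subh tgh z zh u v uh vh; have := levi_civitaP br ip u v z.
by rewrite ![ip _ z]dotC !zh ?tgh ?subh // mulr0 add0r.
Qed.

(** This is the form in which the bound on the dimension of h is used. *)
Lemma exists_common_zero h (phi psi : {scalar g}) :
  (2 < \dim h)%N -> exists y, [/\ y \in h, y != 0, phi y = 0 & psi y = 0].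
Proof.
move=> dimh.
have drop U (f : {scalar g}) :
    (\dim U <= (\dim (U :&: lker (linfun (f : g -> R^o)))).+1)%N.
  rewrite -(limg_ker_dim (linfun (f : g -> R^o)) U) -addn1 leq_add2l.
  by rewrite (leq_trans (dimvS (subvf _))) // dimvf.
set U := (h :&: lker (linfun (phi : g -> R^o)))%VS.
set W := (U :&: lker (linfun (psi : g -> R^o)))%VS.
have W0 : (0 < \dim W)%N.
  have dimU : (1 < \dim U)%N := leq_trans dimh (drop h phi).
  exact: leq_trans dimU (drop U psi).
exists (vpick W).
have : vpick W \in W := memv_pick W.
rewrite !memv_cap !memv_ker !lfunE => /andP[/andP[-> /eqP ->] /eqP ->].
by rewrite vpick0 -dimv_eq0 -lt0n W0.
Qed.

End InnerProduct.

(** * Coordinates in the filiform algebra *)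

Section Filiform.
Variables (R : realType) (g : vectType R) (br : {bilinear g -> g -> g}).
Variable X : nat -> g.
Hypothesis brxx : forall x, br x x = 0.
Hypothesis Xbasis : basis_of fullv [:: X 1%N; X 2%N; X 3%N; X 4%N; X 5%N; X 6%N].
Hypothesis br1X : forall i : nat, (2 <= i <= 5)%N -> br (X 1%N) (X i) = X i.+1.
Hypothesis br23 : br (X 2%N) (X 3%N) = - X 6%N.
Hypothesis brX0 : forall i j : nat, (1 <= i < j)%N -> (j <= 6)%N ->
    ~~ ((i == 1%N) && (j <= 5)%N) -> ~~ ((i == 2%N) && (j == 3%N)) ->
    br (X i) (X j) = 0.

Implicit Types (x y : g) (i j k : nat).

Let B := [tuple X 1%N; X 2%N; X 3%N; X 4%N; X 5%N; X 6%N].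

Definition co i : {scalar g} := coord B (inord i.-1).

Lemma coE x : x = co 1 x *: X 1%N + co 2 x *: X 2%N + co 3 x *: X 3%N
  + co 4 x *: X 4%N + co 5 x *: X 5%N + co 6 x *: X 6%N.
Proof.
have eq_inord (i : 'I_6) j : i = j :> nat -> coord B i x = coord B (inord j) x.
  by move=> <-; rewrite inord_val.
rewrite {1}(coord_basis Xbasis (memvf x) : x = \sum_(i < 6) coord B i x *: B`_i).
rewrite !big_ord_recr big_ord0 /= add0r /co.
by do ![congr (_ + _)]; congr (_ *: _); apply: eq_inord.
Qed.

Lemma coX i j : (0 < i <= 6)%N -> (0 < j <= 6)%N -> co i (X j) = (i == j)%:R.
Proof.
move=> /andP[i0 i6] /andP[j0 j6].
have -> : X j = B`_(inord j.-1 : 'I_6).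
  rewrite inordK ?prednK //.
  by case: j j0 j6 => // -[|[|[|[|[|[|]]]]]].
have /= -> := coord_free (inord j.-1) (inord i.-1) (basis_free Xbasis : free B).
rewrite -val_eqE /= !inordK ?prednK // eq_sym.
by case: i i0 i6 => // i; case: j j0 j6.
Qed.

Lemma coD i x y : co i (x + y) = co i x + co i y. Proof. exact: linearD. Qed.

Lemma coN i x : co i (- x) = - co i x. Proof. exact: linearN. Qed.

Lemma coB i x y : co i (x - y) = co i x - co i y. Proof. exact: linearB. Qed.

Lemma coZ i a x : co i (a *: x) = a * co i x. Proof. exact: linearZ. Qed.

Lemma co0 i : co i 0 = 0. Proof. exact: linear0. Qed.

Lemma co_ext x y : (forall i, (0 < i <= 6)%N -> co i x = co i y) -> x = y.
Proof. by move=> e; rewrite (coE x) (coE y) !e. Qed.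

Lemma brC x y : br x y = - br y x.
Proof.
apply/eqP; rewrite -addr_eq0; apply/eqP.
have := brxx (x + y).
by rewrite linearDl !linearDr /= !brxx add0r addr0.
Qed.

Lemma brE x y : br x y =
    (co 1 x * co 2 y - co 2 x * co 1 y) *: X 3%N
  + (co 1 x * co 3 y - co 3 x * co 1 y) *: X 4%N
  + (co 1 x * co 4 y - co 4 x * co 1 y) *: X 5%N
  + (co 1 x * co 5 y - co 5 x * co 1 y
     - (co 2 x * co 3 y - co 3 x * co 2 y)) *: X 6%N.
Proof.
have col z : br x z = co 1 x *: br (X 1%N) z + co 2 x *: br (X 2%N) z
    + co 3 x *: br (X 3%N) z + co 4 x *: br (X 4%N) z + co 5 x *: br (X 5%N) z
    + co 6 x *: br (X 6%N) z.
  by rewrite {1}(coE x) !linearDl /= !linearZl_LR.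
have brxX1 : br x (X 1%N) =
    - (co 2 x *: X 3%N + co 3 x *: X 4%N + co 4 x *: X 5%N + co 5 x *: X 6%N).
  rewrite col brxx scaler0 add0r !(brC _ (X 1%N)) (@brX0 1 6) // !br1X //.
  by rewrite oppr0 scaler0 addr0 !scalerN -!opprD.
have brxX2 : br x (X 2%N) = co 1 x *: X 3%N + co 3 x *: X 6%N.
  rewrite col br1X // brxx (brC (X 3%N)) br23 opprK.
  rewrite (brC (X 4%N)) (brC (X 5%N)) (brC (X 6%N)) !brX0 //.
  by rewrite oppr0 !scaler0 !addr0.
have brxX3 : br x (X 3%N) = co 1 x *: X 4%N - co 2 x *: X 6%N.
  rewrite col br1X // brxx br23.
  rewrite (brC (X 4%N)) (brC (X 5%N)) (brC (X 6%N)) !brX0 //.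
  by rewrite oppr0 !scaler0 !addr0 scalerN.
have brxX4 : br x (X 4%N) = co 1 x *: X 5%N.
  rewrite col br1X // brxx (brC (X 5%N)) (brC (X 6%N)) !brX0 //.
  by rewrite oppr0 !scaler0 !addr0.
have brxX5 : br x (X 5%N) = co 1 x *: X 6%N.
  by rewrite col br1X // brxx (brC (X 6%N)) !brX0 // oppr0 !scaler0 !addr0.
have brxX6 : br x (X 6%N) = 0.
  by rewrite col brxx !brX0 // !scaler0 !addr0.
rewrite {1}(coE y) !linearDr /= !linearZr_LR /=.
rewrite brxX1 brxX2 brxX3 brxX4 brxX5 brxX6 scaler0 addr0.
apply: co_ext => i _.
rewrite !(coD, coZ, coN); ring.
Qed.

Lemma co_br x y :
  [/\ co 1 (br x y) = 0, co 2 (br x y) = 0,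
      co 3 (br x y) = co 1 x * co 2 y - co 2 x * co 1 y,
      co 4 (br x y) = co 1 x * co 3 y - co 3 x * co 1 y &
      co 5 (br x y) = co 1 x * co 4 y - co 4 x * co 1 y /\
      co 6 (br x y) = co 1 x * co 5 y - co 5 x * co 1 y
                      - (co 2 x * co 3 y - co 3 x * co 2 y)].
Proof.
rewrite brE !(coD, coZ) !coX //=; do !split; ring.
Qed.


(** The subspaces cut out by the vanishing of the first n coordinates form a
    filtration that every inner derivation shifts by one. *)
Lemma co_br_shift n x y : (forall i, (0 < i <= n)%N -> co i y = 0) ->
  forall i, (0 < i <= n.+1)%N -> (i <= 6)%N -> co i (br x y) = 0.
Proof.
move=> y0 i /andP[i0 lein] i6.
have {}y0 j : (0 < j < i)%N -> co j y = 0.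
  by case/andP=> j0 ltji; rewrite y0 // j0 -ltnS (leq_trans ltji).
have [e1 e2 e3 e4 [e5 e6]] := co_br x y.
case: i i0 i6 y0 {lein} => [|[|[|[|[|[|[|i]]]]]]] // _ _ y0;
  rewrite ?e1 ?e2 ?e3 ?e4 ?e5 ?e6 // !y0 //; ring.
Qed.

Lemma ad_nilpotent x y : iter 6 (br x) y = 0.
Proof.
suff shift n i : (0 < i <= n)%N -> (i <= 6)%N -> co i (iter n (br x) y) = 0.
  by apply: co_ext => i /andP[i0 i6]; rewrite co0 shift ?i0.
elim: n i => [|n IHn] i; first by case: i.
by move=> ltin i6; apply: (@co_br_shift (minn n 6)) => // [j jn|]; [apply: IHn|]; lia.
Qed.

(** Off the ideal spanned by X_2, ..., X_6, the operator ad y has the largest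
    possible rank, four. *)
Lemma centralizer_of_off_ideal y v : co 1 y != 0 -> br y v = 0 ->
  exists a s, v = a *: y + s *: X 6%N.
Proof.
move=> y1 yv0; have [_ _ e3 e4 [e5 e6]] := co_br y v.
rewrite yv0 !co0 in e3 e4 e5 e6.
pose a := co 1 v / co 1 y; exists a, (co 6 v - a * co 6 y).
have prop j : 0 = co 1 y * co j v - co j y * co 1 v -> co j v = a * co j y.
  by move=> /esym/subr0_eq ej; apply: (mulfI y1); rewrite ej /a; field.
apply: co_ext => i i6; rewrite coD !coZ coX //.
have v2 := prop 2 e3; have v3 := prop 3 e4; have v4 := prop 4 e5.
have v5 : co 5 v = a * co 5 y.
  by apply: prop; rewrite e6 v2 v3; ring.
case: i i6 => [|[|[|[|[|[|[|i]]]]]]] //= _; rewrite ?v2 ?v3 ?v4 ?v5 /a; by field.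
Qed.

Lemma mem_coords (h : {vspace g}) y :
  (forall i, (0 < i <= 6)%N -> co i y = 0 \/ X i \in h) -> y \in h.
Proof.
move=> yh; have term i : (0 < i <= 6)%N -> co i y *: X i \in h.
  by case/yh => [-> | Xh]; rewrite ?scale0r ?mem0v ?memvZ.
by rewrite (coE y) !memvD ?term.
Qed.

(** * Totally geodesic subalgebras lie in the span of X_2, ..., X_6 *)

Section TotallyGeodesic.
Variables (ip : {dot g for (idfun : R -> R)}) (h : {vspace g}).
Hypothesis subh : subalgebra br h.
Hypothesis tgh : totally_geodesic br ip h.
Hypothesis properh : h <> fullv.
Hypothesis dimh : (2 < \dim h)%N.

Let skew := totally_geodesic_skew subh tgh.

Lemma normalizer_centralizes z :
    (forall v, v \in h -> ip z v = 0) -> (forall v, v \in h -> br z v \in h) ->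
  forall v, v \in h -> br z v = 0.
Proof.
move=> zh norm v vh.
exact: (skew_nilpotent_eq0 norm (skew zh) vh (ad_nilpotent z v)).
Qed.

(** The nilpotent operator ad y preserves the vectors of h whose first
    coordinate vanishes; a nonzero one which it kills is a multiple of X_6. *)
Lemma mem_X6_off_ideal y : y \in h -> co 1 y != 0 -> X 6%N \in h.
Proof.
move=> yh y1; have [u [uh u0 u1 _]] := exists_common_zero (co 1) (co 1) dimh.
have iterh n : iter n (br y) u \in h by elim: n => //= n; apply: subh.
have iter1 n : co 1 (iter n (br y) u) = 0.
  by case: n => //= n; have [] := co_br y (iter n (br y) u).
(* The last nonzero iterate of ad y on u. *)
have [n vn0 /(centralizer_of_off_ideal y1)[a [s vE]]] :
    exists2 n, iter n (br y) u != 0 & br y (iter n (br y) u) = 0.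
  have ex : exists n, iter n (br y) u == 0.
    by exists 6%N; rewrite ad_nilpotent.
  case: (ex_minnP ex) => -[|n] /=; first by rewrite (negPf u0).
  move=> /eqP nil min; exists n => //.
  by apply/negP => /min; rewrite ltnn.
have := iter1 n; rewrite vE coD !coZ coX // mulr0 addr0 => /eqP.
rewrite mulf_eq0 (negPf y1) orbF => /eqP a0.
move: vn0 (iterh n); rewrite vE a0 scale0r add0r scaler_eq0 negb_or.
by case/andP=> s0 _; rewrite -{2}[X 6%N](scalerK s0) => /memvZ.
Qed.

(** By descending induction on i, if y were outside the ideal then every X_i
    would be in h: once X_{i+1}, ..., X_6 are in h, the component of X_i
    orthogonal to h normalizes h, hence commutes with y, hence is a
    combination of y and X_6, which both lie in h. *)
Lemma sub_ideal y : y \in h -> co 1 y = 0.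
Proof.
move=> yh; apply/eqP/negPn/negP => y1; apply: properh.
have X6h := mem_X6_off_ideal yh y1.
suff Xh i : (0 < i <= 6)%N -> X i \in h.
  apply/eqP; rewrite eqEsubv subvf; apply/subvP => v _.
  by apply: mem_coords => i /Xh; right.
move=> i6; have [n] := ubnP (6 - i); elim: n i i6 => // n IHn i i6 lt_n.
have [->//|ni6] := eqVneq i 6%N.
(* The induction runs on 6 - i, so the hypothesis covers all later vectors. *)
have tail j : (i < j <= 6)%N -> X j \in h.
  move=> /andP[ltij j6]; by apply: IHn; lia.
have normX v : br (X i) v \in h.
  rewrite brC memvN; apply: mem_coords => j /andP[j0 j6].
  have [leji|ltij] := leqP j i; last by right; rewrite tail ?ltij.
  left; apply: (@co_br_shift i.-1) => // [k|]; last first.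
    by rewrite j0 (leq_trans leji) ?leqSpred.
  by move=> ki; rewrite coX; [case: eqP => //| |]; lia.
have [x xh zh] := orthogonal_projection ip h (X i).
have cent : br (X i - x) y = 0.
  apply: normalizer_centralizes => // v vh.
  by rewrite linearBl /= memvB ?normX ?subh.
have zE : br y (X i - x) = 0 by rewrite brC cent oppr0.
have [a [s z_h]] := centralizer_of_off_ideal y1 zE.
have : X i - x = 0.
  by apply/(@dot_eq0 _ _ ip)/zh; rewrite z_h memvD ?memvZ.
by move/eqP; rewrite subr_eq0 => /eqP ->.
Qed.

(** * Subalgebras contained in the span of X_2, ..., X_6 *)

Let area x y := co 2 x * co 3 y - co 3 x * co 2 y.

Lemma br_in_ideal x y :
  co 1 x = 0 -> co 1 y = 0 -> br x y = - area x y *: X 6%N.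
Proof.
by move=> x1 y1; rewrite brE x1 y1 !(mul0r, mulr0) !subr0 !scale0r !add0r.
Qed.

Lemma X6_neq0 : X 6%N != 0.
Proof.
apply/eqP => /(congr1 (co 6)); rewrite coX // co0 => /eqP.
by rewrite oner_eq0.
Qed.

Lemma mem_X6_of_area x y : x \in h -> y \in h -> area x y != 0 -> X 6%N \in h.
Proof.
move=> xh yh xy; have := subh xh yh.
rewrite br_in_ideal ?sub_ideal // => /(memvZ (- area x y)^-1).
by rewrite scalerK ?oppr_eq0.
Qed.

Lemma exists_normal : exists2 z, co 1 z = 1 & forall v, v \in h -> ip z v = 0.
Proof.
have [x xh zh] := orthogonal_projection ip h (X 1%N).
by exists (X 1%N - x); rewrite // coB coX // (sub_ideal xh) subr0.
Qed.

(** A subalgebra without X_6 is isotropic for area, so on it one of the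
    coordinates 2 and 3 controls the other.  One further linear condition
    produces x = a X_4 + b X_6 and another one y = c X_5 + d X_6 in h; then
    [z,x] = a X_5 and [z,y] = c X_6, and skewness makes X_5, as well as X_6,
    orthogonal to y. *)
Lemma perp_X6_absurd : (forall y, y \in h -> ip (X 6%N) y = 0) -> False.
Proof.
move=> X6perp; have X6h : X 6%N \notin h.
  by apply/negP => /X6perp/dot_eq0/eqP; rewrite (negPf X6_neq0).
have coX6 y : y \in h -> y != 0 -> (forall i, (0 < i <= 5)%N -> co i y = 0) -> False.
  move=> yh y0 yi; move: y0 yh; rewrite (coE y).
  rewrite (yi 1%N) // (yi 2%N) // (yi 3%N) // (yi 4%N) // (yi 5%N) //.
  rewrite !scale0r !add0r.
  rewrite scaler_eq0 negb_or => /andP[y6 _] /(memvZ (co 6 y)^-1).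
  by rewrite scalerK // (negPf X6h).
have iso x y : x \in h -> y \in h -> area x y = 0.
  by move=> xh yh; apply/eqP; apply: contraNT X6h; apply: mem_X6_of_area.
have [j jP] : exists j, forall y, y \in h -> co j y = 0 -> co 2 y = 0 /\ co 3 y = 0.
  have [[u uh u2]|no] := pselect (exists2 u, u \in h & co 2 u != 0).
    exists 2%N => y yh y2; split=> //; apply: (mulfI u2).
    by have := iso u y uh yh; rewrite /area y2 !mulr0 subr0.
  exists 3%N => y yh y3; split=> //.
  by apply/eqP/negPn/negP => y2; apply: no; exists y.
have [x [xh x0 xj x5]] := exists_common_zero (co j) (co 5) dimh.
have [y [yh y0 yj y4]] := exists_common_zero (co j) (co 4) dimh.
have [x2 x3] := jP _ xh xj; have [y2 y3] := jP _ yh yj.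
have x1 := sub_ideal xh; have y1 := sub_ideal yh.
have [z z1 zh] := exists_normal.
have brzx : br z x = co 4 x *: X 5%N.
  by rewrite brE x1 x2 x3 x5 z1 !(mulr0, oppr0, subr0, scale0r, mul1r, addr0, add0r).
have brzy : br z y = co 5 y *: X 6%N.
  by rewrite brE y1 y2 y3 y4 z1 !(mulr0, oppr0, subr0, scale0r, mul1r, addr0, add0r).
have x4 : co 4 x != 0.
  apply/eqP => x4; apply: (coX6 x) => // i.
  by case: i => [|[|[|[|[|[|i]]]]]].
apply/negP: y0; rewrite negbK; apply/eqP/(@dot_eq0 _ _ ip).
have := skew zh xh yh; rewrite brzx brzy !linearZl_LR /= (X6perp _ xh) mulr0 addr0.
move/eqP; rewrite mulf_eq0 (negPf x4) /= => /eqP X5y.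
rewrite {1}(coE y) y1 y2 y3 y4 !scale0r !add0r linearDl !linearZl_LR /=.
by rewrite X5y X6perp // !mulr0 addr0.
Qed.

(** Here [z,X_5] = X_6 and [z,X_6] = 0, so skewness gives <X_6,X_6> = 0. *)
Lemma X5_X6_absurd : X 5%N \in h -> X 6%N \in h -> False.
Proof.
move=> X5h X6h; have [z z1 zh] := exists_normal.
have := skew zh X5h X6h; rewrite !brE z1 !coX //=.
rewrite !(mulr0, oppr0, subr0, scale0r, mul1r, addr0, add0r, scale1r) linear0l addr0.
by move/dot_eq0/eqP; rewrite (negPf X6_neq0).
Qed.

(** Skewness of ad w reads area(w,u) <X_6,v> + area(w,v) <X_6,u> = 0.  The
    pair (y0, y0) gives area(w,y0) = 0, and then the pair (u, y0) gives
    area(w,u) = 0. *)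
Lemma perp_area y0 w : y0 \in h -> ip (X 6%N) y0 != 0 ->
    co 1 w = 0 -> (forall v, v \in h -> ip w v = 0) ->
  forall u, u \in h -> area w u = 0.
Proof.
move=> y0h X6y0 w1 wh.
have eqn u : u \in h -> area w u * ip (X 6%N) y0 + area w y0 * ip (X 6%N) u = 0.
  move=> uh; have := skew wh uh y0h.
  rewrite (br_in_ideal w1 (sub_ideal uh)) (br_in_ideal w1 (sub_ideal y0h)).
  rewrite !linearZl_LR /= !mulNr -opprD => /eqP.
  by rewrite oppr_eq0 => /eqP.
have wy0 : area w y0 = 0.
  have /eqP := eqn y0 y0h; rewrite -mulr2n mulrn_eq0 /= mulf_eq0 (negPf X6y0) orbF.
  by move/eqP.
move=> u uh; have /eqP := eqn u uh.
by rewrite wy0 mul0r addr0 mulf_eq0 (negPf X6y0) orbF => /eqP.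
Qed.

(** By [perp_area] the elements of h are area-orthogonal to all of the ideal,
    in particular to X_2 and X_3: their coordinates 2 and 3 vanish.  By
    dimension h is the span of X_4, X_5, X_6. *)
Lemma isotropic_absurd y0 : y0 \in h -> ip (X 6%N) y0 != 0 ->
  (forall u v, u \in h -> v \in h -> area u v = 0) -> False.
Proof.
move=> y0h X6y0 iso.
have rad j u : (j == 2%N) || (j == 3%N) -> u \in h -> area (X j) u = 0.
  move=> j23 uh; have [x xh wh] := orthogonal_projection ip h (X j).
  have Xj1 : co 1 (X j) = 0 by case/pred2P: j23 => ->; rewrite coX.
  have := perp_area y0h X6y0 _ wh uh; rewrite coB Xj1 (sub_ideal xh) subr0.
  move=> /(_ erefl) wu; have xu := iso x u xh uh.
  by rewrite -[RHS]addr0 -{1}wu -xu /area !coB; ring.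
have u3 u : u \in h -> co 3 u = 0.
  by move=> uh; have := rad 2%N u isT uh; rewrite /area !coX //= mul1r mul0r subr0.
have u2 u : u \in h -> co 2 u = 0.
  move=> uh; have := rad 3%N u isT uh; rewrite /area !coX //= mul1r mul0r sub0r.
  by move/eqP; rewrite oppr_eq0 => /eqP.
have [x [xh x0 x4 x5]] := exists_common_zero (co 4) (co 5) dimh.
have [y [yh y_0 y4 y6]] := exists_common_zero (co 4) (co 6) dimh.
apply: X5_X6_absurd.
- move: y_0 (yh); rewrite (coE y) (sub_ideal yh) u2 // u3 // y4 y6.
  rewrite !scale0r !add0r addr0 scaler_eq0 negb_or => /andP[y5 _].
  by move/(memvZ (co 5 y)^-1); rewrite scalerK.
- move: x0 (xh); rewrite (coE x) (sub_ideal xh) u2 // u3 // x4 x5.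
  rewrite !scale0r !add0r scaler_eq0 negb_or => /andP[x6 _].
  by move/(memvZ (co 6 x)^-1); rewrite scalerK.
Qed.

(** The part of the ideal orthogonal to h now has vanishing coordinates 2
    and 3, so projecting to h preserves these coordinates.  Hence the
    compression phi of ad z maps h to vectors with zero second coordinate, and
    those to vectors of K, the elements of h with coordinates 2 and 3 zero.
    On K it vanishes: X_6 is in K and X_5 is not, so K is spanned by X_6 and at
    most one further vector y, and phi y, being in K and orthogonal to both,
    is zero.  Thus phi is skew with phi^3 = 0, so phi = 0, although phi sends
    the projection of X_2 to a vector whose third coordinate is 1. *)
Lemma symplectic_absurd y0 u v : y0 \in h -> ip (X 6%N) y0 != 0 ->
  u \in h -> v \in h -> area u v != 0 -> False.
Proof.
move=> y0h X6y0 uh vh uv; have X6h := mem_X6_of_area uh vh uv.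
have perp23 w : co 1 w = 0 -> (forall t, t \in h -> ip w t = 0) ->
    co 2 w = 0 /\ co 3 w = 0.
  move=> w1 wh; have wu := perp_area y0h X6y0 w1 wh uh.
  have wv := perp_area y0h X6y0 w1 wh vh.
  (* Both coordinates of w are recovered from area w u and area w v. *)
  have cramer c : co c w * area u v = co c u * area w v - co c v * area w u
      -> co c w = 0.
    by rewrite wu wv !mulr0 subr0 => /eqP; rewrite mulf_eq0 (negPf uv) orbF => /eqP.
  by split; apply: cramer; rewrite /area; ring.
have /choice[pr prP] x :
    exists p, p \in h /\ forall t, t \in h -> ip (x - p) t = 0.
  by have [p ph xp] := orthogonal_projection ip h x; exists p.
have prh x : pr x \in h by case: (prP x).
have ip_pr x t : t \in h -> ip (pr x) t = ip x t.
  move=> th; have [_ /(_ t th)] := prP x.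
  by rewrite linearBl /= => /subr0_eq ->.
have pr23 x : co 1 x = 0 -> co 2 (pr x) = co 2 x /\ co 3 (pr x) = co 3 x.
  move=> x1; have [_ /perp23] := prP x.
  by rewrite !coB x1 (sub_ideal (prh x)) subr0 => /(_ erefl)[/subr0_eq-> /subr0_eq->].
have [z z1 zh] := exists_normal.
pose phi y := pr (br z y).
have phi2 y : y \in h -> co 2 (phi y) = 0.
  by move=> yh; have [c1 c2 _ _ _] := co_br z y; have [->] := pr23 _ c1.
have phi3 y : y \in h -> co 3 (phi y) = co 2 y.
  move=> yh; have [c1 _ c3 _ _] := co_br z y; have [_ ->] := pr23 _ c1.
  by rewrite c3 z1 (sub_ideal yh) mul1r mulr0 subr0.
have phi_skew s t : s \in h -> t \in h -> ip (phi s) t + ip (phi t) s = 0.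
  by move=> sh th; rewrite !ip_pr //; apply: skew.
have phi_perp y : y \in h -> ip (phi y) y = 0.
  move=> yh; have /eqP := phi_skew y y yh yh.
  by rewrite -mulr2n mulrn_eq0 /= => /eqP.
have brzX6 : br z (X 6%N) = 0.
  by rewrite brE !coX //= !(mulr0, oppr0, subr0, scale0r, addr0).
have phi_perp6 y : y \in h -> ip (phi y) (X 6%N) = 0.
  move=> yh; have := phi_skew y _ yh X6h.
  by rewrite [ip (phi (X 6%N)) y]ip_pr // brzX6 linear0l addr0.
(* A nonzero fifth coordinate would put X_5 in h next to X_6. *)
have line6 t : t \in h -> co 2 t = 0 -> co 3 t = 0 -> co 4 t = 0 -> t = co 6 t *: X 6%N.
  move=> th t2 t3 t4; have tE := coE t.
  rewrite (sub_ideal th) t2 t3 t4 !scale0r !add0r in tE.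
  have [t5|t5] := eqVneq (co 5 t) 0; first by rewrite {1}tE t5 scale0r add0r.
  exfalso; apply: X5_X6_absurd => //; rewrite -[X 5%N](scalerK t5) memvZ //.
  by rewrite -(addrK (co 6 t *: X 6%N) (_ *: X 5%N)) -tE memvB ?memvZ.
have phi_eq0 y : y \in h -> co 2 y = 0 -> co 3 y = 0 -> phi y = 0.
  move=> yh y2 y3; apply: (@dot_eq0 _ _ ip).
  have [y4|y4] := eqVneq (co 4 y) 0.
    by rewrite ip_pr ?prh // (line6 y) // linearZr /= brzX6 scaler0 linear0l.
  (* K has at most one dimension beyond X_6, so phi y is in <y, X_6>. *)
  pose a := co 4 (phi y) / co 4 y.
  have := line6 (phi y - a *: y).
  rewrite !coB !coZ phi2 // phi3 // y2 y3 mulr0 subr0 divfK // subrr.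
  rewrite memvB ?memvZ ?prh // => /(_ isT erefl erefl erefl)/eqP.
  rewrite subr_eq => /eqP {2}->.
  by rewrite linearDr /= !linearZr_LR /= phi_perp // phi_perp6 // !mulr0 addr0.
have phi0 y : y \in h -> phi y = 0.
  move=> yh; apply: (@skew_nilpotent_eq0 _ _ ip h phi 2) => //= [t _|].
    exact: prh.
  by rewrite phi_eq0 ?phi2 ?phi3 ?phi2 ?prh.
have X21 : co 1 (X 2%N) = 0 by rewrite coX.
have := phi3 _ (prh (X 2%N)); rewrite phi0 ?prh // co0.
have [-> _] := pr23 _ X21; rewrite coX // => /eqP.
by rewrite eq_sym oner_eq0.
Qed.

Lemma totally_geodesic_absurd : False.
Proof.
have [X6perp|no] := pselect (forall y, y \in h -> ip (X 6%N) y = 0).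
  exact: perp_X6_absurd.
have [y0 y0h X6y0] : exists2 y, y \in h & ip (X 6%N) y != 0.
  apply: contrapT => none; apply: no => y yh.
  by apply/eqP/negPn/negP => X6y; apply: none; exists y.
apply: (isotropic_absurd y0h X6y0) => u v uh vh.
by apply/eqP/negPn/negP; apply: symplectic_absurd X6y0 uh vh.
Qed.

End TotallyGeodesic.

End Filiform.

Theorem theorem1p19 (R : realType) (g : vectType R)
    (br : {bilinear g -> g -> g}) (X : nat -> g) :
  is_lie_bracket br ->
  basis_of fullv [:: X 1%N; X 2%N; X 3%N; X 4%N; X 5%N; X 6%N] ->
  (forall i : nat, (2 <= i <= 5)%N -> br (X 1%N) (X i) = X i.+1) ->
  br (X 2%N) (X 3%N) = - X 6%N ->
  (forall i j : nat, (1 <= i < j)%N -> (j <= 6)%N ->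
    ~~ ((i == 1%N) && (j <= 5)%N) -> ~~ ((i == 2%N) && (j == 3%N)) ->
    br (X i) (X j) = 0) ->
  forall ip : {dot g for (idfun : R -> R)},
    ~ exists h : {vspace g},
        [/\ subalgebra br h, totally_geodesic br ip h,
            h <> fullv & (2 < \dim h)%N].
Proof.
move=> [brxx _] Xbasis br1X br23 brX0 ip [h [subh tgh properh dimh]].
exact: (totally_geodesic_absurd brxx Xbasis br1X br23 brX0 subh tgh properh dimh).
Qed.
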